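(* Let $t_0<t_1$, $0<a<b<1$, $a_0\in\mathbb{R}$, let $\alpha:\mathbb{R}\to[a,b]$ be continuously differentiable with bounded derivative, and let $\Pi\subset(t_0,t_1)\times\mathbb{R}$ be a countable set of points such that $\sum_{(x,y)\in\Pi}|y|^{-1/b'}<\infty$ for some $b'$ with $b<b'<1$. Then there exists a unique $f\in D[t_0,t_1)$ such that $$f(t)=a_0+\sum_{(x,y)\in\Pi}1_{(t_0,t]}(x)\,y^{\langle-1/\alpha(f(x_-))\rangle}\qquad(t_0\le t<t_1).$$ In particular $f(t_0)=a_0$. Moreover, for each $s$ and $t$ with $t_0\le s<t<t_1$, $f(t)$ is completely determined given $f(s)$ and the points of the set $\Pi\cap((s,t]\times\mathbb{R})$ (that is, for the fixed function $\alpha$, $f(t)$ is a function of $f(s)$ and $\Pi\cap((s,t]\times\mathbb{R})$ only).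
   Context: $D[t_0,t_1)$ denotes the càdlàg functions $f:[t_0,t_1)\to\mathbb{R}$: $f$ is right continuous at every $u\in[t_0,t_1)$, and the left limit $f(u_-):=\lim_{t\nearrow u}f(t)$ exists (and is finite) for every $u\in(t_0,t_1]$, including at $u=t_1$. For real $r,s$ write $r^{\langle s\rangle}=\mathrm{sign}(r)|r|^s$. $1_{A}$ is the indicator function of $A$. The summability condition on $\Pi$ forces $y\ne0$ for all $(x,y)\in\Pi$ and makes all the sums absolutely convergent. *)

(* Defs.v *)
From HB Require Import structures.
From mathcomp Require Import all_boot all_order all_algebra.
From mathcomp Require Import all_classical all_reals all_analysis.

Set Implicit Arguments.
Unset Strict Implicit.
Unset Printing Implicit Defensive.

Import Order.TTheory GRing.Theory Num.Theory.
Import numFieldNormedType.Exports.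

Local Open Scope classical_set_scope.
Local Open Scope ring_scope.

Definition spow (R : realType) (r s : R) : R := Num.sg r * `|r| `^ s.

Definition left_lim (R : realType) (f : R -> R) (u : R) : R := lim (f @ u^'-).

(* Elements of D[t0,t1) are represented by total functions; only the values
   on [t0, t1[ are relevant, so equality in D[t0,t1) is equality on [t0, t1[. *)
Definition cadlag (R : realType) (t0 t1 : R) (f : R -> R) : Prop :=
  (forall u, t0 <= u < t1 -> f x @[x --> u^'+] --> f u) /\
  (forall u, t0 < u <= t1 -> cvg (f @ u^'-)).

Definition C1_bounded_derivative (R : realType) (g : R -> R) : Prop :=
  [/\ forall x, derivable g x 1,
      continuous (derive1 g) &
      bounded_fun (derive1 g)].

(* Absolutely convergent sum over an arbitrary index set. The value is finite
   if and only if the family is absolutely summable: when the positive or the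
   negative part diverges the difference is +oo or -oo. *)
Definition asum (R : realType) (T : choiceType) (A : set T) (g : T -> R) :
    \bar R :=
  (\esum_(p in A) (EFin \o g)^\+ p - \esum_(p in A) (EFin \o g)^\- p)%E.

(* [p.2 != 0] is stated explicitly because MathComp-Analysis sets
   [0 `^ s = 0] for [s != 0], whereas here 0 to a negative power is +oo, so
   that summability excludes [p.2 = 0]. *)
Definition point_set (R : realType) (t0 t1 b : R) (Pi : set (R * R)) : Prop :=
  [/\ Pi `<=` [set` `]t0, t1[] `*` setT,
      countable Pi,
      forall p, Pi p -> p.2 != 0 &
      exists2 b', b < b' < 1 &
        summable Pi (fun p : R * R => (`|p.2| `^ (- b'^-1))%:E)].

Definition solution (R : realType) (alpha : R -> R) (t0 t1 a0 : R)
    (Pi : set (R * R)) (f : R -> R) : Prop :=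
  cadlag t0 t1 f /\
  forall t, t0 <= t < t1 ->
    (f t)%:E = (a0%:E + asum Pi (fun p : R * R =>
      (\1_[set` `]t0, t]] p.1 * spow p.2 (- (alpha (left_lim f p.1))^-1))%R))%E.

(* Main.v *)
Require Import Defs.
From mathcomp Require Import all_boot all_order all_algebra.
From mathcomp Require Import all_classical all_reals all_analysis.
From mathcomp Require Import finmap lra.
Import Order.TTheory GRing.Theory Num.Theory.
Import numFieldNormedType.Exports.
Set Implicit Arguments.
Unset Strict Implicit.
Unset Printing Implicit Defensive.
Local Open Scope classical_set_scope.
Local Open Scope ring_scope.

(** The jump at the point [p = (x, y)] depends on the path only through its left
limit at [x], so the equation for [f] closes up on the left limits
[F u = f(u-)]: they solve [F u = a0 + sum over x < u of h_p (F x)], where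
[h_p v] is the signed power of [y] with exponent [- 1 / alpha v].

All but finitely many [|y|] are large, and all of them are bounded below, so
[|h_p|] and the Lipschitz constant of [h_p] are both at most a fixed multiple
[m_p] of [|y| ^ (- 1 / b')]: the room between [b] and [b'] absorbs the factor
[ln |y|] produced by differentiating in the exponent
([spow_jump_bounds]). Hence both bounds are summable.

The map [F |-> a0 + sum over x < u of h_p (F x)] need not contract the sup norm,
since the total mass of [m] may exceed 1. It contracts a weighted one. For
[w u = exp (2 * sum over x < u of m_p)] one has
[sum over x < u of m_p * w x <= w u / 2] ([weighted_sum_le]); this is the
discrete form of the fact that [2 k' exp (2 k)] is the derivative of
[exp (2 k)], and it holds for atoms of any size because [w] is evaluated just
before each jump. So the map halves distances in the norm [sup |F| / w], which
gives uniqueness ([jump_sum_unique]) and, by Picard iteration, existence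
([jump_sum_exists]).

It remains to pass between paths and left limits. A sum of summable jumps over
[x <= t] is right continuous in [t], with left limit at [u] the sum over [x < u],
by dominated convergence ([jump_path_right], [jump_path_left]). For the last
assertion, the increments of a solution after time [s] involve only the points
in [(s, t]], so on that window the left limits solve the same equation with
starting value [f s], and uniqueness for it applies ([solution_determined]). *)

(** * Real sums over an arbitrary index set *)

Section RealSums.
Context {R : realType} {I : choiceType}.
Implicit Types (A : set I) (g h m : I -> R).

Definition rsum A g : R := fine (asum A g).

Definition rsummable A g := summable A (EFin \o g).

Lemma rsummable_le A m g : rsummable A m ->
  (forall p, A p -> `|g p| <= m p) -> rsummable A g.
Proof.
move=> Am gm; apply: le_lt_trans Am; apply: le_esum => p Ap /=.
by rewrite lee_fin (le_trans (gm p Ap))// ler_norm.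
Qed.

Lemma rsummableD A g h : rsummable A g -> rsummable A h ->
  rsummable A (fun p => g p + h p).
Proof. exact: summableD. Qed.

Lemma rsummableB A g h : rsummable A g -> rsummable A h ->
  rsummable A (fun p => g p - h p).
Proof. exact: summableB. Qed.

Lemma rsummable_pos A g : rsummable A g -> rsummable A (fun p => Num.max (g p) 0).
Proof.
move=> Ag; apply: (rsummable_le (m := fun p => `|g p|)) => [|p _].
  by apply: le_lt_trans Ag; apply: le_esum => p _ /=; rewrite normr_id.
by rewrite ger0_norm ?le_max ?lexx ?orbT// ge_max ler_norm normr_ge0.
Qed.

Lemma rsummable_neg A g : rsummable A g -> rsummable A (fun p => Num.max (- g p) 0).
Proof.
move=> Ag; apply: (@rsummable_pos A (fun p => - g p)).
by move: Ag; rewrite /rsummable summableN.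
Qed.

Lemma maxrBN (x : R) : Num.max x 0 - Num.max (- x) 0 = x.
Proof.
by have [x0|x0] := leP 0 x; [rewrite max_r ?oppr_le0// subr0|
  rewrite max_l ?oppr_ge0 ?(ltW x0)// add0r opprK].
Qed.

(** Both parts of a summable family have finite sums, so that the extended-real
difference is a genuine number and [rsum] does not lose information. *)
Lemma asum_fin A g : rsummable A g -> asum A g = (rsum A g)%:E.
Proof.
move=> Ag; rewrite /rsum fineK// /asum fin_numB.
have := summable_funepos Ag; have := summable_funeneg Ag.
rewrite !summableE => An Ap.
rewrite (@eq_esum _ _ _ _ (fun x => `|((EFin \o g)^\+ x)%E|)%E) ?Ap/=; last first.
  by move=> i _; rewrite gee0_abs.
by rewrite (@eq_esum _ _ _ _ (fun x => `|((EFin \o g)^\- x)%E|)%E)//;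
  move=> i _; rewrite gee0_abs.
Qed.

Lemma eq_asum A g h : (forall p, A p -> g p = h p) -> asum A g = asum A h.
Proof.
by move=> gh; congr (_ - _)%E; apply: eq_esum => p Ap;
  rewrite ?funeposE ?funenegE /= gh.
Qed.

Lemma eq_rsum A g h : (forall p, A p -> g p = h p) -> rsum A g = rsum A h.
Proof. by move=> /eq_asum; rewrite /rsum => ->. Qed.

Lemma esum_rsum A g : rsummable A g -> (forall p, A p -> 0 <= g p) ->
  \esum_(p in A) (g p)%:E = (rsum A g)%:E.
Proof.
move=> Ag g0; rewrite -asum_fin// /asum [X in (_ - X)%E]esum1; last first.
  by move=> p Ap; rewrite funenegE/= max_r// lee_fin oppr_le0 g0.
by rewrite sube0; apply: eq_esum => p Ap; rewrite funeposE/= max_l// lee_fin g0.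
Qed.

Lemma rsumB_nneg A g h : rsummable A g -> rsummable A h ->
  (forall p, A p -> 0 <= g p) -> (forall p, A p -> 0 <= h p) ->
  rsum A (fun p => g p - h p) = rsum A g - rsum A h.
Proof.
move=> Ag Ah g0 h0; apply: EFin_inj.
rewrite -asum_fin; last exact: rsummableB.
rewrite EFinB -(esum_rsum Ag g0) -(esum_rsum Ah h0).
exact: (esumB Ag Ah g0 h0).
Qed.

Lemma rsumD_nneg A g h : rsummable A g -> rsummable A h ->
  (forall p, A p -> 0 <= g p) -> (forall p, A p -> 0 <= h p) ->
  rsum A (fun p => g p + h p) = rsum A g + rsum A h.
Proof.
move=> Ag Ah g0 h0; apply: EFin_inj.
rewrite EFinD -(esum_rsum Ag g0) -(esum_rsum Ah h0) -esumD//.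
by rewrite -esum_rsum//; [exact: rsummableD|move=> p Ap; rewrite addr_ge0 ?g0 ?h0].
Qed.

(** Splitting each family into positive and negative parts turns the difference
into one of two nonnegative families, where extended-real sums are additive. *)
Lemma rsumB A g h : rsummable A g -> rsummable A h ->
  rsum A (fun p => g p - h p) = rsum A g - rsum A h.
Proof.
move=> Ag Ah.
have max_ge0 (x : R) : 0 <= Num.max x 0 by rewrite le_max lexx orbT.
pose gp p := Num.max (g p) 0; pose gn p := Num.max (- g p) 0.
pose hp p := Num.max (h p) 0; pose hn p := Num.max (- h p) 0.
have Agp := rsummable_pos Ag; have Agn := rsummable_neg Ag.
have Ahp := rsummable_pos Ah; have Ahn := rsummable_neg Ah.
rewrite (@eq_rsum A _ (fun p => (gp p + hn p) - (gn p + hp p))); last first.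
  by move=> p _; rewrite -{1}(maxrBN (g p)) -{1}(maxrBN (h p)) /gp /gn /hp /hn; lra.
rewrite rsumB_nneg; try exact: rsummableD;
  try by move=> p _; rewrite addr_ge0// max_ge0.
rewrite !rsumD_nneg//; try by move=> p _; rewrite max_ge0.
rewrite -[in RHS](@eq_rsum A (fun p => gp p - gn p) g); last first.
  by move=> p _; rewrite maxrBN.
rewrite -[in RHS](@eq_rsum A (fun p => hp p - hn p) h); last first.
  by move=> p _; rewrite maxrBN.
by rewrite !rsumB_nneg//; try (by move=> p _; rewrite max_ge0); lra.
Qed.

Lemma rsum_ge0 A g : rsummable A g -> (forall p, A p -> 0 <= g p) -> 0 <= rsum A g.
Proof.
by move=> Ag g0; rewrite -lee_fin -esum_rsum//; apply: esum_ge0 => p Ap;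
  rewrite lee_fin g0.
Qed.

Lemma ler_rsum A g h : rsummable A g -> rsummable A h ->
  (forall p, A p -> g p <= h p) -> rsum A g <= rsum A h.
Proof.
move=> Ag Ah gh; rewrite -subr_ge0 -rsumB//; apply: rsum_ge0.
  exact: rsummableB.
by move=> p Ap; rewrite subr_ge0 gh.
Qed.

Lemma rsum0 A : rsum A (fun=> 0) = 0.
Proof.
rewrite /rsum /asum !esum1 ?sube0// => p _.
  by rewrite funenegE /= oppr0 max_l.
by rewrite funeposE /= max_l.
Qed.

Lemma rsumN A g : rsummable A g -> rsum A (fun p => - g p) = - rsum A g.
Proof.
move=> Ag; rewrite -sub0r -[in RHS](rsum0 A) -rsumB//.
- by apply: eq_rsum => p _; rewrite sub0r.
- by rewrite /rsummable /summable esum1 ?ltry// => p _ /=; rewrite normr0.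
Qed.

Lemma ler_norm_rsum A m g : rsummable A m ->
  (forall p, A p -> `|g p| <= m p) -> `|rsum A g| <= rsum A m.
Proof.
move=> Am gm; have Ag := rsummable_le Am gm.
rewrite ler_norml; apply/andP; split.
  rewrite -rsumN//; apply: ler_rsum => //.
    by move: Am; rewrite /rsummable summableN.
  by move=> p /gm; rewrite ler_norml => /andP[].
by apply: ler_rsum => // p /gm; rewrite ler_norml => /andP[].
Qed.

Lemma fin_sum_le_rsum A g (s : seq I) : rsummable A g ->
  (forall p, A p -> 0 <= g p) -> uniq s -> [set` s] `<=` A ->
  \sum_(p <- s) g p <= rsum A g.
Proof.
move=> Ag g0 us sA; rewrite -lee_fin -esum_rsum//.
apply: esum_ge; exists [set` s]; first by split => //; exact: finite_seq.
by rewrite -fsbig_seq// sumEFin.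
Qed.

Lemma rsum_le_fin A g (C : R) : rsummable A g ->
  (forall p, A p -> 0 <= g p) ->
  (forall s : seq I, uniq s -> [set` s] `<=` A -> \sum_(p <- s) g p <= C) ->
  rsum A g <= C.
Proof.
move=> Ag g0 gC; rewrite -lee_fin -esum_rsum//.
apply: ge_ereal_sup => _ [X [finX XA] <-].
rewrite fsbig_finite// sumEFin lee_fin; apply: gC; first exact: fset_uniq.
by move=> p /=; rewrite in_fset_set// => /set_mem; exact: XA.
Qed.

Lemma rsum_fin_approx A g (e : R) : 0 < e -> rsummable A g ->
  (forall p, A p -> 0 <= g p) ->
  exists s : seq I, [/\ uniq s, [set` s] `<=` A & rsum A g - e < \sum_(p <- s) g p].
Proof.
move=> e0 Ag g0.
have Efin : esum A (EFin \o g) = (rsum A g)%:E by rewrite -esum_rsum.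
have supfin : ereal_sup [set (\sum_(x \in X) (EFin \o g) x)%E | X in fsets A]
  \is a fin_num by rewrite -/(esum _ _) Efin.
have [_ [X [finX XA] <-]] := ub_ereal_sup_adherent e0 supfin.
rewrite -/(esum _ _) Efin fsbig_finite// sumEFin -EFinB lte_fin => lt_e.
exists (fset_set X); split => //.
by move=> p /=; rewrite in_fset_set// => /set_mem; exact: XA.
Qed.

Lemma rsummable_mkcond A m (c : pred I) : rsummable A m ->
  rsummable A (fun p => (c p)%:R * m p).
Proof.
move=> Am; apply: (rsummable_le (m := fun p => `|m p|)) => [|p _].
  by apply: le_lt_trans Am; apply: le_esum => p _ /=; rewrite normr_id.
by case: (c p); rewrite ?mul1r// mul0r normr0.
Qed.

Lemma rsummableZ A m (c : R) : rsummable A m -> rsummable A (fun p => c * m p).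
Proof.
move=> Am; pose n p := `|m p|.
have An : rsummable A n.
  by apply: le_lt_trans Am; apply: le_esum => p _ /=; rewrite normr_id.
apply: (@le_lt_trans _ _ (`|c| * rsum A n)%:E); last exact: ltry.
apply: ge_ereal_sup => _ [X [finX XA] <-].
rewrite fsbig_finite// sumEFin lee_fin.
rewrite (eq_bigr (fun p => `|c| * n p)); last by move=> p _; rewrite normrM.
rewrite -mulr_sumr ler_wpM2l// fin_sum_le_rsum//.
  by move=> p _; exact: normr_ge0.
by move=> p /=; rewrite in_fset_set// => /set_mem; exact: XA.
Qed.

(** Dominated convergence when each term is eventually equal to its limit: all
but finitely many indices contribute less than [e] in total, and the remaining
finitely many terms have become stationary. *)
Lemma rsum_cvg (T : Type) (F : set_system T) {FF : Filter F} A m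
    (g : T -> I -> R) (g0 : I -> R) :
  rsummable A m -> (forall t p, A p -> `|g t p| <= m p) ->
  (forall p, A p -> `|g0 p| <= m p) ->
  (forall p, A p -> \forall t \near F, g t p = g0 p) ->
  rsum A (g t) @[t --> F] --> rsum A g0.
Proof.
move=> Am gm g0m gg0; apply/cvgrPdist_lt => e e0.
have m0 p : A p -> 0 <= m p by move=> /g0m; exact: le_trans.
(* The difference of two families bounded by [m] is bounded by [m + m]. *)
have Am2 : rsummable A (fun p => m p + m p) by exact: rsummableD.
have m2_ge0 p : A p -> 0 <= m p + m p by move=> /m0 ?; rewrite addr_ge0.
have [s [us sA se]] := rsum_fin_approx e0 Am2 m2_ge0.
have near_s : \forall t \near F, forall p, p \in s -> g t p = g0 p.
  elim: s {us se} sA => [|q s IHs] qsA; first exact: nearW.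
  have sA : [set` s] `<=` A.
    by move=> p ps; apply: qsA; rewrite /= inE ps orbT.
  apply: filterS2 (IHs sA) (gg0 q (qsA q (mem_head _ _))) => t gs gq p.
  by rewrite inE => /orP[/eqP->//|]; exact: gs.
apply: filterS near_s => t gs.
have Ag0 := rsummable_le Am g0m; have Agt := rsummable_le Am (gm t).
rewrite -rsumB//.
pose inn p := (p \in s)%:R * (m p + m p); have Ainn : rsummable A inn.
  exact: rsummable_mkcond.
apply: (@le_lt_trans _ _ (rsum A (fun p => (m p + m p) - inn p))).
  apply: ler_norm_rsum => [|p Ap]; first exact: rsummableB.
  rewrite /inn; have [ps|_] := boolP (p \in s).
    by rewrite gs// subrr normr0 mul1r subrr.
  by rewrite mul0r subr0 (le_trans (ler_normB _ _))// lerD// ?g0m ?gm.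
rewrite rsumB//; have : \sum_(p <- s) (m p + m p) <= rsum A inn.
  rewrite (_ : \sum_(p <- s) _ = \sum_(p <- s) inn p); last first.
    by apply: eq_big_seq => p ps; rewrite /inn ps mul1r.
  by apply: fin_sum_le_rsum => // p Ap; rewrite mulr_ge0// m2_ge0.
by lra.
Qed.

End RealSums.

(** * The weight that turns the jump equation into a contraction *)

Lemma seq_argmax (R : realType) (I : eqType) (x : I -> R) (s : seq I) :
  s != [::] -> exists2 p, p \in s & forall q, q \in s -> x q <= x p.
Proof.
elim: s => // p [|p' s] IHs _.
  by exists p => [|q]; rewrite inE// => /eqP->.
have [//|r rs r_max] := IHs.
have [pr|rp] := leP (x p) (x r).
  exists r => [|q]; first by rewrite inE rs orbT.
  by rewrite inE => /orP[/eqP->//|]; exact: r_max.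
exists p => [|q]; first exact: mem_head.
by rewrite inE => /orP[/eqP->//|/r_max/le_trans]; apply; exact: ltW.
Qed.

Section Weight.
Context {R : realType} {I : choiceType} (A : set I) (x m : I -> R).
Hypothesis Am : rsummable A m.
Hypothesis m_ge0 : forall p, A p -> 0 <= m p.

Definition cumul (u : R) : R := rsum A (fun p => (x p < u)%R%:R * m p).

(** Strict inequality in [cumul] makes the weight left continuous: an atom at
[u] does not count in [weight u]. *)
Definition weight (u : R) : R := expR (2 * cumul u).

Lemma cumul_ge0 u : 0 <= cumul u.
Proof.
by apply: rsum_ge0 => [|p Ap]; [exact: rsummable_mkcond|rewrite mulr_ge0// m_ge0].
Qed.

Lemma cumul_le u : cumul u <= rsum A m.
Proof.
apply: ler_rsum => // [|p Ap]; first exact: rsummable_mkcond.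
by rewrite ler_piMl ?m_ge0// lern1 leq_b1.
Qed.

Lemma weight_ge1 u : 1 <= weight u.
Proof. by rewrite -expR0 ler_expR mulr_ge0// cumul_ge0. Qed.

Lemma weight_le u : weight u <= expR (2 * rsum A m).
Proof. by rewrite ler_expR ler_pM2l// cumul_le. Qed.

(** The discrete form of integrating [k' exp (2 k)] to [exp (2 k) / 2]. Peel off
the atoms at the largest time [v < u]: those strictly before [v] are bounded by
[weight v / 2] by induction, those at [v], of total mass [d], add
[d * weight v], and [1 + 2 d <= exp (2 d)]. Several atoms may share a time,
so the induction removes all atoms at [v] at once. *)
Lemma fin_weighted_le (s : seq I) u : uniq s -> [set` s] `<=` A ->
  \sum_(p <- s | x p < u) m p * weight (x p) <= weight u / 2.
Proof.
move=> us sA; move: {2}(count _ _) (leqnn (count (fun p => x p < u) s)) => n.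
elim: n u => [|n IHn] u.
  rewrite leqn0 -[_ == _]negbK -lt0n -has_count => /hasPn s0.
  rewrite big_seq_cond big1; first by rewrite divr_ge0 ?expR_ge0.
  by move=> p /andP[/s0/negbTE->].
move=> cn; have [s0|s_neq0] := eqVneq [seq p <- s | x p < u] [::].
  by rewrite -big_filter s0 big_nil divr_ge0 ?expR_ge0.
have [r + r_max] := seq_argmax x s_neq0.
rewrite mem_filter => /andP[ru rs]; set v := x r in ru.
have le_v p : p \in s -> x p < u -> x p <= v.
  by move=> ps pu; apply: r_max; rewrite mem_filter pu.
have below : \sum_(p <- s | x p < v) m p * weight (x p) <= weight v / 2.
  apply: IHn; rewrite -ltnS; apply: leq_trans cn.
  rewrite -!size_filter.
  have -> : [seq p <- s | x p < v] = [seq p <- [seq p <- s | x p < u] | x p < v].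
    rewrite -filter_predI; apply: eq_filter => p /=.
    by case: ltP => //= pv; rewrite (lt_trans pv ru).
  rewrite [ltnLHS]size_filter -(count_predC (fun p => x p < v)) -addn1 leq_add2l.
  rewrite -has_count; apply/hasP; exists r; first by rewrite mem_filter ru.
  by rewrite /= /v ltxx.
have at_v : \sum_(p <- s | x p == v) m p <= cumul u - cumul v.
  rewrite /cumul -rsumB; do ?exact: rsummable_mkcond.
  apply: (@le_trans _ _
      (\sum_(p <- s) ((x p < u)%R%:R * m p - (x p < v)%R%:R * m p))).
    rewrite big_mkcond big_seq [leRHS]big_seq; apply: ler_sum => p ps.
    have mp := m_ge0 (sA _ ps).
    case: eqP => [->|_]; first by rewrite ru ltxx mul1r mul0r subr0.
    rewrite -mulrBl mulr_ge0// subr_ge0 ler_nat.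
    by case: (ltP (x p) v) => // pv; rewrite (lt_trans pv ru).
  apply: fin_sum_le_rsum => // [|p Ap].
    by apply: rsummableB; exact: rsummable_mkcond.
  rewrite -mulrBl mulr_ge0 ?m_ge0// subr_ge0 ler_nat.
  by case: (ltP (x p) v) => // pv; rewrite (lt_trans pv ru).
have -> : \sum_(p <- s | x p < u) m p * weight (x p) =
    \sum_(p <- s | x p < v) m p * weight (x p) +
    (\sum_(p <- s | x p == v) m p) * weight v.
  rewrite (bigID (fun p => x p < v))/=; congr (_ + _).
    by apply: eq_bigl => p; case: (ltP (x p) v) => [pv|_];
      rewrite ?andbF// (lt_trans pv ru).
  rewrite mulr_suml big_seq_cond [RHS]big_seq_cond.
  rewrite (eq_bigl (fun p => (p \in s) && (x p == v))).
    by apply: eq_bigr => p /andP[_ /eqP->].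
  move=> p; have [ps|//] /= := boolP (p \in s).
  apply/idP/eqP => [/andP[pu]|->]; last by rewrite ru ltxx.
  by rewrite -leNgt => vp; apply/eqP; rewrite eq_le vp le_v.
set d := \sum_(p <- s | x p == v) m p in at_v *.
have -> : weight u = expR (2 * (cumul u - cumul v)) * weight v.
  by rewrite /weight -expRD; congr expR; lra.
have step : 1 + 2 * d <= expR (2 * (cumul u - cumul v)).
  by apply: le_trans (expR_ge1Dx _); lra.
have wv : 0 < weight v by exact: expR_gt0.
by nra.
Qed.

(** This passes from finite to infinite sums of [fin_weighted_le], in the shape
in which the contraction estimate consumes it. *)
Lemma weighted_sum_le (g : I -> R) (C u : R) : 0 <= C ->
  (forall p, A p -> x p < u -> `|g p| <= C * (m p * weight (x p))) ->
  `|rsum A (fun p => (x p < u)%R%:R * g p)| <= C * (weight u / 2).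
Proof.
move=> C0 gC; pose b p := (x p < u)%R%:R * (C * (m p * weight (x p))).
have b_ge0 p : A p -> 0 <= b p.
  by move=> Ap; rewrite !mulr_ge0// ?m_ge0// expR_ge0.
have Ab : rsummable A b.
  apply: (rsummable_le (rsummableZ (C * expR (2 * rsum A m)) Am)) => p Ap.
  rewrite ger0_norm ?b_ge0// /b.
  have := weight_le (x p); have := m_ge0 Ap; set w := weight _; set W := expR _.
  move=> mp wW; case: (_ < _)%R; rewrite ?mul0r ?mul1r.
    by rewrite -[leRHS]mulrA ler_wpM2l// [leLHS]mulrC ler_wpM2r.
  by rewrite !mulr_ge0// expR_ge0.
apply: (@le_trans _ _ (rsum A b)).
  apply: ler_norm_rsum => // p Ap; rewrite /b normrM.
  have [pu|_] := ltP (x p) u; first by rewrite normr1 !mul1r gC.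
  by rewrite normr0 !mul0r.
apply: rsum_le_fin => // s us sA.
apply: le_trans (ler_wpM2l C0 (fin_weighted_le u us sA)).
rewrite mulr_sumr [leRHS]big_mkcond/= le_eqVlt; apply/orP; left; apply/eqP.
by apply: eq_bigr => p _; rewrite /b; case: ifP; rewrite ?mul1r ?mul0r.
Qed.

End Weight.

(** * The equation for the left limits *)

Lemma lt_half_pow (R : realType) (K e : R) : 0 <= K -> 0 < e ->
  exists n : nat, K / 2 ^+ n < e.
Proof.
move=> K0 e0; have Ke : 0 <= K / e by rewrite divr_ge0// ltW.
exists (Num.bound (K / e)); rewrite ltr_pdivrMr ?exprn_gt0// mulrC -ltr_pdivrMr//.
apply: lt_le_trans (archi_boundP Ke) _.
by rewrite -natrX ler_nat ltnW// ltn_expl.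
Qed.

Lemma eq_half_pow (R : realType) (K y z : R) : 0 <= K ->
  (forall n : nat, `|y - z| <= K / 2 ^+ n) -> y = z.
Proof.
move=> K0 yz; apply/eqP; rewrite -subr_eq0 -normr_eq0; apply/eqP.
have [yz0|] := ltP 0 `|y - z|;
  last by move=> ?; apply/eqP; rewrite eq_le normr_ge0 andbT.
by have [n] := lt_half_pow K0 yz0; rewrite ltNge yz.
Qed.

Section JumpEquation.
Context {R : realType} {I : choiceType} (A : set I) (x m : I -> R).
Variable h : I -> R -> R.
Hypothesis Am : rsummable A m.
Hypothesis h_le : forall p v, A p -> `|h p v| <= m p.
Hypothesis h_lip : forall p v w, A p -> `|h p v - h p w| <= m p * `|v - w|.

(** The right-hand side of the equation at the left limit [u-], the atoms at [u]
itself being excluded. *)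
Definition jump_sum (c : R) (F : R -> R) (u : R) : R :=
  c + rsum A (fun p => (x p < u)%R%:R * h p (F (x p))).

Lemma jump_bound_ge0 p : A p -> 0 <= m p.
Proof. by move=> Ap; exact: le_trans (h_le 0 Ap). Qed.
Local Notation m_ge0 := jump_bound_ge0.

Lemma rsummable_jumps (c : pred I) (v : I -> R) :
  rsummable A (fun p => (c p)%:R * h p (v p)).
Proof.
by apply: rsummable_mkcond; apply: (rsummable_le Am) => p Ap; exact: h_le.
Qed.

Lemma jump_sum_le c F u : `|jump_sum c F u - c| <= rsum A m.
Proof.
rewrite /jump_sum addrAC subrr add0r; apply: ler_norm_rsum => // p Ap.
by case: (_ < _)%R; rewrite ?mul1r ?mul0r ?h_le// normr0 m_ge0.
Qed.

(** Only the values at times before [u] enter, which is why the hypothesis may be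
restricted to them. *)
Lemma jump_sum_contract c F G C u : 0 <= C ->
  (forall p, A p -> x p < u ->
     `|F (x p) - G (x p)| <= C * weight A x m (x p)) ->
  `|jump_sum c F u - jump_sum c G u| <= C * (weight A x m u / 2).
Proof.
move=> C0 FG; rewrite /jump_sum opprD addrACA subrr add0r.
rewrite -rsumB; do ?exact: rsummable_jumps.
under eq_rsum do rewrite -mulrBr.
apply: weighted_sum_le => // [|p Ap xpu]; first exact: m_ge0.
apply: le_trans (h_lip _ _ Ap) _.
by rewrite mulrCA ler_wpM2l ?m_ge0// FG.
Qed.

Lemma rsum_bound_ge0 : 0 <= rsum A m.
Proof. by apply: rsum_ge0 => //; exact: m_ge0. Qed.

(** The equations are required at the atoms only, since the map reads its argument
nowhere else. The difference of two solutions is bounded by twice the mass of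
[m], hence has finite weighted norm, and this norm is halved at will. *)
Lemma jump_sum_unique c F G :
  (forall p, A p -> F (x p) = jump_sum c F (x p)) ->
  (forall p, A p -> G (x p) = jump_sum c G (x p)) ->
  forall p, A p -> F (x p) = G (x p).
Proof.
move=> FE GE; pose C := rsum A m + rsum A m.
have C0 : 0 <= C by rewrite addr_ge0 ?rsum_bound_ge0.
have FG n p : A p -> `|F (x p) - G (x p)| <= C / 2 ^+ n * weight A x m (x p).
  elim: n p => [|n IHn] p Ap; rewrite FE ?GE//.
    rewrite divr1 -[leLHS]mulr1 ler_pM//; last first.
      by apply: weight_ge1 => //; exact: m_ge0.
    have := ler_normB (jump_sum c F (x p) - c) (jump_sum c G (x p) - c).
    rewrite (_ : _ - c - _ = jump_sum c F (x p) - jump_sum c G (x p)); last by lra.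
    by move/le_trans; apply; rewrite lerD// jump_sum_le.
  apply: le_trans (jump_sum_contract _ (C := C / 2 ^+ n) _ _) _.
  - by rewrite divr_ge0// exprn_ge0.
  - by move=> q Aq _; exact: IHn.
  - by rewrite exprSr invfM; set w := weight _ _ _ _; lra.
move=> p Ap.
apply: (@eq_half_pow _ (C * weight A x m (x p))) => [|n].
  by rewrite mulr_ge0// expR_ge0.
by rewrite mulrAC FG.
Qed.

(** Picard iteration from the constant [c]. *)
Lemma jump_sum_exists c : exists F, forall u, F u = jump_sum c F u.
Proof.
pose C := rsum A m.
have C0 : 0 <= C := rsum_bound_ge0.
pose F_ n := iter n (jump_sum c) (fun=> c).
pose w := weight A x m.
have w0 u : 0 <= w u by exact: expR_ge0.
(* The first step moves by at most the mass of [m], and so does the distance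
   from the start to any later iterate; each iteration halves that bound. *)
have F_close n k u : `|F_ (n + k)%N u - F_ n u| <= C / 2 ^+ n * w u.
  elim: n u => [|n IHn] u.
    rewrite divr1 -[leLHS]mulr1 ler_pM//; last first.
      by apply: weight_ge1 => //; exact: m_ge0.
    by rewrite add0n /F_; case: k => [|k]; rewrite ?subrr ?normr0//= jump_sum_le.
  rewrite addSn /F_ !iterS.
  apply: le_trans (jump_sum_contract _ (C := C / 2 ^+ n) _ _) _.
  - by rewrite divr_ge0// exprn_ge0.
  - by move=> q Aq _; exact: IHn.
  - by rewrite exprSr invfM -/w; lra.
have F_cvg u : cvg (F_ n u @[n --> \oo]).
  apply: cauchy_cvg; apply: cauchy_exP => e e0.
  have Cw : 0 <= C * w u by rewrite mulr_ge0.
  have [n ne] := lt_half_pow Cw e0.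
  exists (F_ n u); exists n => // i /= ni; rewrite /ball/= distrC -(subnKC ni).
  by apply: le_lt_trans (F_close n _ u) _; rewrite mulrAC.
pose F u := lim (F_ n u @[n --> \oo]).
have F_lim n u : `|F u - F_ n u| <= C / 2 ^+ n * w u.
  apply/ler_addgt0Pr => e e0.
  have /cvgrPdist_lt /(_ _ e0) [N _ NF] := F_cvg u.
  have := NF (n + N)%N (leq_addl _ _) => /= close.
  have := F_close n N u; move: close; rewrite -/(F u) => close1 close2.
  rewrite (_ : F u - F_ n u =
    (F u - F_ (n + N)%N u) + (F_ (n + N)%N u - F_ n u)); last by lra.
  by apply: le_trans (ler_normD _ _) _; lra.
exists F => u; apply: (@eq_half_pow _ (C * w u)) => [|n]; first by rewrite mulr_ge0.
have := F_lim n.+1 u.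
have : `|jump_sum c (F_ n) u - jump_sum c F u| <= C / 2 ^+ n * (w u / 2).
  apply: jump_sum_contract => [|p Ap _]; first by rewrite divr_ge0// exprn_ge0.
  by rewrite distrC F_lim.
rewrite -[jump_sum c (F_ n) u]/(F_ n.+1 u) exprSr invfM => d1 d2.
rewrite (_ : F u - _ =
  (F u - F_ n.+1 u) + (F_ n.+1 u - jump_sum c F u)); last by lra.
by apply: le_trans (ler_normD _ _) _; lra.
Qed.

Lemma jumps_le (c : pred I) (v : I -> R) p : A p ->
  `|(c p)%:R * h p (v p)| <= m p.
Proof.
by move=> Ap; case: (c p); rewrite ?mul1r ?mul0r ?h_le// normr0 m_ge0.
Qed.

(** Near [u] on the right, each fixed time [x p] lies on the same side of [t] as
of [u], so every term is eventually stationary. *)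
Lemma jump_path_right (v : I -> R) (s u : R) :
  rsum A (fun p => (s < x p <= t)%R%:R * h p (v p)) @[t --> u^'+] -->
  rsum A (fun p => (s < x p <= u)%R%:R * h p (v p)).
Proof.
apply: (@rsum_cvg _ _ _ _ _ A m) => // [t p Ap|p Ap|p Ap].
- exact: (jumps_le (fun p => s < x p <= t)).
- exact: (jumps_le (fun p => s < x p <= u)).
- have [pu|up] := leP (x p) u.
    near=> t; rewrite (_ : (x p <= t) = true)//.
    by apply: le_trans pu _; near: t; exact: nbhs_right_ge.
  near=> t; rewrite (_ : (x p <= t) = false)//.
  by apply/negbTE; rewrite -ltNge; near: t; exact: nbhs_right_lt.
Unshelve. all: by end_near. Qed.

(** An atom at [u] is missed by all [t < u], so the limit only counts [x p < u]. *)
Lemma jump_path_left (v : I -> R) (s u : R) :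
  rsum A (fun p => (s < x p <= t)%R%:R * h p (v p)) @[t --> u^'-] -->
  rsum A (fun p => (s < x p < u)%R%:R * h p (v p)).
Proof.
apply: (@rsum_cvg _ _ _ _ _ A m) => // [t p Ap|p Ap|p Ap].
- exact: (jumps_le (fun p => s < x p <= t)).
- exact: (jumps_le (fun p => s < x p < u)).
- have [pu|up] := ltP (x p) u.
    near=> t; rewrite (_ : (x p <= t) = true)//.
    by near: t; exact: nbhs_left_ge.
  near=> t; rewrite (_ : (x p <= t) = false)//.
  by apply/negbTE; rewrite -ltNge (lt_le_trans _ up)//.
Unshelve. all: by end_near. Qed.

End JumpEquation.

(** * Summable bounds on the jumps *)

Lemma C1_bounded_lipschitz (R : realType) (g : R -> R) :
  C1_bounded_derivative g ->
  exists2 L : R, 0 <= L & forall v w, `|g v - g w| <= L * `|v - w|.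
Proof.
case=> dg _ [M [_ gM]].
exists (`|M| + 1) => [|v w]; first by rewrite addr_ge0.
wlog vw : v w / w <= v.
  move=> H; have [/H//|/ltW/H] := leP w v.
  by rewrite distrC (distrC w).
have dg' y : y \in `]w, v[ -> is_derive y 1 g (derive1 g y).
  by move=> _; rewrite derive1E; exact: derivableP.
have cg : {within `[w, v], continuous g}.
  apply: continuous_subspaceT => y.
  exact/differentiable_continuous/derivable1_diffP.
have [y _ ->] := MVT_segment vw dg' cg.
rewrite normrM ler_wpM2r// gM//.
by rewrite (le_lt_trans (ler_norm _))// ltrDl.
Qed.

Lemma expR_sub_le (R : realType) (u v : R) : expR u - expR v <= (u - v) * expR u.
Proof.
have -> : expR v = expR u * expR (v - u) by rewrite -expRD; congr expR; lra.
by have := expR_ge1Dx (v - u); have := expR_gt0 u; nra.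
Qed.

(** The derivative of [exp (e l)] in [e] is [l exp (e l)]. For [0 <= l <= lmax]
it is bounded by its value at the largest [e] and [l]; for [l < 0] the lower bound
[d] on the exponent gives [- l exp (d l) <= 1 / d]. Thus the bound holds
uniformly over all [l], however negative. *)
Lemma expR_lipschitz_exponent (R : realType) (d E lmax l e e' : R) :
  0 < d -> d <= e <= E -> d <= e' <= E -> 0 <= lmax -> l <= lmax ->
  `|expR (e * l) - expR (e' * l)| <=
    (lmax * expR (E * lmax) + d^-1) * `|e - e'|.
Proof.
move=> d0 eE e'E lm0 llm; wlog ee' : e e' eE e'E / e' <= e.
  move=> H; have [/H->//|/ltW/H] := leP e' e.
  by rewrite distrC (distrC e'); apply.
rewrite (@ger0_norm _ (e - e')) ?subr_ge0//.
have [l0|l0] := leP 0 l.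
  rewrite ger0_norm ?subr_ge0 ?ler_expR ?ler_wpM2r//.
  apply: le_trans (expR_sub_le _ _) _.
  have h1 : l * expR (e * l) <= lmax * expR (E * lmax).
    rewrite ler_pM// ?expR_ge0// ler_expR; case/andP: eE => ? ?.
    by rewrite ler_pM//; lra.
  have : 0 < d^-1 by rewrite invr_gt0.
  by nra.
have l_le0 := ltW l0.
rewrite distrC ger0_norm ?subr_ge0 ?ler_expR ?ler_wnM2r//.
apply: le_trans (expR_sub_le _ _) _.
have h1 : - l * expR (e' * l) <= d^-1.
  apply: (@le_trans _ _ (- l * expR (d * l))).
    rewrite ler_wpM2l ?oppr_ge0// ler_expR ler_wnM2r//.
    by case/andP: e'E.
  rewrite -[d * l]opprK expRN -[leRHS]mul1r ler_pdivrMr ?expR_gt0//.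
  rewrite mulrAC ler_pdivlMr// mul1r.
  by have := expR_ge1Dx (- (d * l)); lra.
have : 0 <= lmax * expR (E * lmax) by rewrite mulr_ge0// expR_ge0.
by nra.
Qed.

Lemma expR_le_exponent (R : realType) (d E lmax l e : R) :
  0 < d -> d <= e <= E -> 0 <= lmax -> l <= lmax ->
  expR (e * l) <= expR (E * lmax).
Proof.
move=> d0 /andP[de eE] lm0 llm; rewrite ler_expR.
apply: (@le_trans _ _ (e * lmax)); first by rewrite ler_wpM2l//; lra.
by rewrite ler_wpM2r.
Qed.

Lemma spowE (R : realType) (y r : R) : y != 0 ->
  spow y (- r) = Num.sg y * expR (r * - ln `|y|).
Proof.
by move=> y0; rewrite /spow /powR normr_eq0 (negbTE y0) mulrN mulNr.
Qed.

Lemma norm_sgr_le1 (R : realDomainType) (y : R) : `|Num.sg y| <= 1.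
Proof. by rewrite normr_sg; case: eqP. Qed.

(** With [l = - ln |y|], the size of a jump is [exp (l / alpha v)], which factors
as [|y| ^ (- 1 / b')] times [exp (e l)], where [e = 1 / alpha v - 1 / b'] stays
in an interval bounded away from 0 because [alpha v <= b < b']. The first
factor is summable and the second is bounded and Lipschitz in [e] by the
lemmas above, as [l] is bounded from above. *)
Lemma spow_jump_bounds (R : realType) (a b t0 t1 : R) (alpha : R -> R)
    (Pi : set (R * R)) :
  0 < a -> a < b -> (forall v, a <= alpha v <= b) ->
  C1_bounded_derivative alpha -> point_set t0 t1 b Pi ->
  exists m : R * R -> R,
    [/\ rsummable Pi m,
        forall p v, Pi p -> `|spow p.2 (- (alpha v)^-1)| <= m p &
        forall p v w, Pi p ->
          `|spow p.2 (- (alpha v)^-1) - spow p.2 (- (alpha w)^-1)|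
            <= m p * `|v - w|].
Proof.
move=> a0 ab alpha_ab /C1_bounded_lipschitz[L L0 alphaL].
case=> _ _ Pi_neq0 [b' /andP[bb' b'1] Pi_sum].
have b0 : 0 < b by lra.
have b'0 : 0 < b' by lra.
pose mu (p : R * R) : R := `|p.2| `^ (- b'^-1).
have Amu : rsummable Pi mu by exact: Pi_sum.
have mu_ge0 p : 0 <= mu p by exact: powR_ge0.
pose l (p : R * R) := - ln `|p.2|.
have muE p : Pi p -> mu p = expR (b'^-1 * l p).
  move=> /Pi_neq0 p0; rewrite /mu /powR normr_eq0 (negbTE p0) /l.
  by rewrite mulrN mulNr.
(* A single term [exp (l / b')] is at most the whole sum, and it is at least
   [l / b']. *)
pose lmax := b' * rsum Pi mu.
have lmax0 : 0 <= lmax by apply: mulr_ge0; [exact: ltW|exact: rsum_ge0].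
have l_le p : Pi p -> l p <= lmax.
  move=> Pip; rewrite /lmax mulrC -ler_pdivrMr// mulrC.
  have mup : mu p <= rsum Pi mu.
    rewrite -[leLHS](big_seq1 +%R p mu) fin_sum_le_rsum// => q /=.
    by rewrite inE => /eqP->.
  apply: le_trans mup; rewrite muE//.
  by apply: le_trans (expR_ge1Dx _); rewrite lerDr.
pose d := b^-1 - b'^-1; pose E := a^-1 - b'^-1.
have d0 : 0 < d by rewrite subr_gt0 ltf_pV2// posrE.
have alpha0 v : 0 < alpha v by have /andP[] := alpha_ab v; lra.
have dE v : d <= (alpha v)^-1 - b'^-1 <= E.
  have /andP[av vb] := alpha_ab v; rewrite !lerD2r.
  by rewrite !lef_pV2 ?posrE ?av ?vb.
pose K0 := expR (E * lmax).
pose K := lmax * expR (E * lmax) + d^-1.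
pose K1 := K * (L / a ^+ 2).
have K0_ge0 : 0 <= K0 by exact: expR_ge0.
have K_ge0 : 0 <= K by rewrite addr_ge0 ?invr_ge0 ?(ltW d0)// mulr_ge0.
have K1_ge0 : 0 <= K1.
  by rewrite /K1 mulr_ge0 ?divr_ge0 ?exprn_ge0 ?(ltW a0).
have expE p v : Pi p -> expR ((alpha v)^-1 * l p) =
    mu p * expR (((alpha v)^-1 - b'^-1) * l p).
  by move=> Pip; rewrite muE// -expRD; congr expR; lra.
exists (fun p => (K0 + K1) * mu p); split=> [|p v Pip|p v w Pip].
- exact: rsummableZ.
- rewrite spowE ?Pi_neq0// normrM -[leRHS]mul1r ler_pM ?norm_sgr_le1//.
  rewrite ger0_norm ?expR_ge0// expE// mulrC ler_wpM2r//.
  apply: le_trans (expR_le_exponent d0 (dE v) lmax0 (l_le _ Pip)) _.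
  by rewrite lerDl.
- rewrite !spowE ?Pi_neq0// -mulrBr normrM -[leRHS]mul1r ler_pM ?norm_sgr_le1//.
  rewrite !expE// -mulrBr normrM (ger0_norm (mu_ge0 p)).
  rewrite [(K0 + K1) * _]mulrC -mulrA ler_wpM2l//.
  apply: le_trans (expR_lipschitz_exponent d0 (dE v) (dE w) lmax0 (l_le _ Pip)) _.
  rewrite -/K (_ : _ - _ = (alpha w - alpha v) / (alpha v * alpha w)); last first.
    have := alpha0 v; have := alpha0 w => /lt0r_neq0 w0 /lt0r_neq0 v0.
    rewrite opprB addrA subrK mulrBl invfM mulrA.
    rewrite [alpha w / alpha v / _]mulrAC mulfV// mul1r.
    by rewrite mulrA mulfV// mul1r.
  rewrite normrM normfV distrC (@ger0_norm _ (alpha v * _)); last first.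
    by rewrite mulr_ge0// ltW.
  have inv_le : (alpha v * alpha w)^-1 <= (a ^+ 2)^-1.
    rewrite lef_pV2 ?posrE ?exprn_gt0 ?mulr_gt0// expr2.
    have /andP[av _] := alpha_ab v; have /andP[aw _] := alpha_ab w.
    by rewrite ler_pM// ltW.
  apply: (@le_trans _ _ (K1 * `|v - w|)); last by rewrite ler_wpM2r// lerDr.
  rewrite /K1 -[leRHS]mulrA ler_wpM2l// mulrAC ler_pM//.
  by rewrite invr_ge0 mulr_ge0// ltW.
Qed.

(** * Solutions and their left limits *)

Lemma rsummable_sub (R : realType) (I : choiceType) (A B : set I) (g : I -> R) :
  B `<=` A -> rsummable A g -> rsummable B g.
Proof.
move=> BA; apply: le_lt_trans; apply: le_ereal_sup => _ [X [finX XB] <-].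
by exists X => //; split => //; exact: subset_trans BA.
Qed.

Lemma rsum_setI (R : realType) (I : choiceType) (A B : set I) (g : I -> R) :
  rsum (A `&` B) g = rsum A (fun p => (p \in B)%:R * g p).
Proof.
rewrite /rsum /asum !esum_mkcondr; congr (fine (_ - _)%E); apply: eq_esum => p _.
  by rewrite !funeposE/=; case: ifP; rewrite ?mul1r ?mul0r// max_l.
by rewrite !funenegE/=; case: ifP; rewrite ?mul1r ?mul0r// oppr0 max_l.
Qed.

Definition jump (R : realType) (alpha : R -> R) (p : R * R) (v : R) : R :=
  spow p.2 (- (alpha v)^-1).

Section Solutions.
Context {R : realType} (a b : R) (alpha : R -> R).
Hypothesis a_gt0 : 0 < a.
Hypothesis ltab : a < b.
Hypothesis alpha_ab : forall v, a <= alpha v <= b.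
Hypothesis alphaC1 : C1_bounded_derivative alpha.
Local Notation J := (jump alpha).
Local Notation window s t := ([set` `]s, t]] `*` [set: R]).

Lemma solution_rsum t0 t1 a0 Pi f t : point_set t0 t1 b Pi ->
  solution alpha t0 t1 a0 Pi f -> t0 <= t < t1 ->
  f t = a0 + rsum Pi (fun p => (t0 < p.1 <= t)%R%:R * J p (left_lim f p.1)).
Proof.
move=> PiP [_ fE] t01; have [m [Am J_le _]] :=
  spow_jump_bounds a_gt0 ltab alpha_ab alphaC1 PiP.
apply: EFin_inj; rewrite fE// EFinD -asum_fin; last first.
  by apply: (rsummable_jumps Am (fun p v => J_le p v) (fun p => t0 < p.1 <= t)).
by congr (_ + _)%E; apply: eq_asum => p _; rewrite indicE mem_setE in_itv.
Qed.

Lemma solution_start t0 t1 a0 Pi f : t0 < t1 -> point_set t0 t1 b Pi ->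
  solution alpha t0 t1 a0 Pi f -> f t0 = a0.
Proof.
move=> t01 PiP fS; rewrite (solution_rsum PiP fS) ?lexx//.
rewrite (eq_rsum (h := fun=> 0)) ?rsum0 ?addr0// => p _.
by rewrite lt_le_asym mul0r.
Qed.

(** Only the points in the window [(s, t]] contribute to increments after [s]. *)
Lemma solution_increment t0 t1 a0 Pi f s t u : point_set t0 t1 b Pi ->
  solution alpha t0 t1 a0 Pi f -> t0 <= s -> s <= u <= t -> t < t1 ->
  f u = f s + rsum (Pi `&` window s t)
    (fun p => (s < p.1 <= u)%R%:R * J p (left_lim f p.1)).
Proof.
move=> PiP fS t0s /andP[su ut] tt1.
have [m [Am J_le _]] := spow_jump_bounds a_gt0 ltab alpha_ab alphaC1 PiP.
have AJ (c : pred (R * R)) :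
    rsummable Pi (fun p => (c p)%:R * J p (left_lim f p.1)).
  exact: (rsummable_jumps Am (fun p v => J_le p v)).
rewrite !(solution_rsum PiP fS) ?t0s ?(le_lt_trans su (le_lt_trans ut tt1))//;
  last by rewrite (le_trans t0s su) (le_lt_trans ut tt1).
rewrite -addrA; congr (_ + _); apply/eqP; rewrite addrC -subr_eq; apply/eqP.
rewrite -rsumB; do ?exact: AJ.
rewrite rsum_setI; apply: eq_rsum => p _.
rewrite in_setX in_setT andbT mem_setE in_itv/= -mulrBl.
have [sp|ps] /= := ltP s p.1; last first.
  by rewrite (le_trans ps su) !andbT subrr !mul0r.
rewrite (le_lt_trans t0s sp) andbF subr0/=.
by have [pu|] := leP p.1 u; rewrite ?(le_trans pu ut) ?mul1r// !mul0r mulr0.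
Qed.

(** On a window, the left limits of a solution solve the closed equation started
from the value at the left end. *)
Lemma left_lim_jump_sum t0 t1 a0 Pi f s t u : point_set t0 t1 b Pi ->
  solution alpha t0 t1 a0 Pi f -> t0 <= s -> s < u <= t -> t < t1 ->
  left_lim f u =
    jump_sum (Pi `&` window s t) fst J (f s) (left_lim f) u.
Proof.
move=> PiP fS t0s /andP[su ut] tt1; set P := _ `&` _.
have [m [Am J_le _]] := spow_jump_bounds a_gt0 ltab alpha_ab alphaC1 PiP.
have PPi : P `<=` Pi by exact: subIsetl.
have Pm := rsummable_sub PPi Am.
apply: cvg_lim => //; rewrite /jump_sum.
rewrite (eq_rsum (h := fun p => (s < p.1 < u)%R%:R * J p (left_lim f p.1)));
  last by move=> p [_ [/=]]; rewrite in_itv/= => /andP[->].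
apply: cvg_trans; last first.
  exact: (cvgD (cvg_cst (f s)) (@jump_path_left _ _ _ fst m J Pm
    (fun p v Pp => J_le p v (PPi p Pp)) (fun p => left_lim f p.1) s u)).
apply: near_eq_cvg; near=> r.
rewrite (solution_increment (u := r) PiP fS t0s _ tt1)//.
apply/andP; split; first by near: r; exact: nbhs_left_ge.
by apply: le_trans ut; near: r; exact: nbhs_left_le.
Unshelve. all: by end_near. Qed.

(** The intervals of definition and the points outside the window may differ:
the left limits of both solutions solve one and the same window equation. *)
Lemma solution_determined s t (t0 t1 a0 : R) Pi f (t0' t1' a0' : R) Pi' f' :
  s < t ->
  point_set t0 t1 b Pi -> solution alpha t0 t1 a0 Pi f -> t0 <= s -> t < t1 ->
  point_set t0' t1' b Pi' -> solution alpha t0' t1' a0' Pi' f' ->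
  t0' <= s -> t < t1' ->
  f s = f' s -> Pi `&` window s t = Pi' `&` window s t -> f t = f' t.
Proof.
move=> st PiP fS t0s tt1 PiP' fS' t0s' tt1' ff' PP'.
have [m [Am J_le J_lip]] := spow_jump_bounds a_gt0 ltab alpha_ab alphaC1 PiP.
have PPi : Pi `&` window s t `<=` Pi by exact: subIsetl.
have F_eq p : (Pi `&` window s t) p -> left_lim f p.1 = left_lim f' p.1.
  move: p; apply: (@jump_sum_unique _ _ _ fst m J _ _ _ (f s)).
  - exact: rsummable_sub Am.
  - by move=> p v /PPi; exact: J_le.
  - by move=> p v w /PPi; exact: J_lip.
  - move=> p [_ [/= + _]]; rewrite in_itv/= => spt.
    exact: (left_lim_jump_sum PiP fS).
  - move=> p [_ [/= + _]]; rewrite in_itv/= => spt.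
    by rewrite ff' PP'; exact: (left_lim_jump_sum PiP' fS').
have stt : s <= t <= t by rewrite (ltW st) lexx.
have fE := solution_increment PiP fS t0s stt tt1.
have fE' := solution_increment PiP' fS' t0s' stt tt1'.
rewrite -PP' -ff' in fE'.
rewrite fE'.
rewrite (eq_rsum (h := fun p => (s < p.1 <= t)%R%:R * J p (left_lim f' p.1))) in fE.
  exact: fE.
by move=> p Pp; rewrite F_eq.
Qed.

(** The fixed point [F] is meant to be the family of left limits; the path [f]
rebuilt from it indeed has left limits [F], which makes it a solution. *)
Lemma solution_exists t0 t1 a0 Pi : point_set t0 t1 b Pi ->
  exists f, solution alpha t0 t1 a0 Pi f.
Proof.
move=> PiP.
have [m [Am J_le J_lip]] := spow_jump_bounds a_gt0 ltab alpha_ab alphaC1 PiP.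
have J_le' p v : Pi p -> `|J p v| <= m p by exact: J_le.
have [F FE] := jump_sum_exists fst Am J_le' J_lip a0.
pose f u := a0 + rsum Pi (fun p => (t0 < p.1 <= u)%R%:R * J p (F p.1)).
have f_left u : f r @[r --> u^'-] --> F u.
  rewrite FE /jump_sum (eq_rsum (h := fun p => (t0 < p.1 < u)%R%:R * J p (F p.1))).
    by apply: cvgD; [exact: cvg_cst|exact: (jump_path_left Am J_le')].
  move=> p Pip; have [/(_ _ Pip)[/=]] := PiP.
  by rewrite in_itv/= => /andP[->].
have left_limE : left_lim f = F by apply/funext => u; exact: cvg_lim.
exists f; split.
  split=> u _; last by apply/cvg_ex; exists (F u).
  by apply: cvgD; [exact: cvg_cst|exact: (jump_path_right Am J_le')].
move=> t t01; rewrite left_limE /f EFinD -asum_fin; last first.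
  exact: (rsummable_jumps Am J_le' (fun p => t0 < p.1 <= t)).
by congr (_ + _)%E; apply: eq_asum => p _; rewrite indicE mem_setE in_itv.
Qed.

End Solutions.

Theorem theorem2p2 (R : realType) (a b : R) (alpha : R -> R)
    (a_gt0 : 0 < a) (ltab : a < b) (b_lt1 : b < 1)
    (alpha_ab : forall x, a <= alpha x <= b)
    (alphaC1 : C1_bounded_derivative alpha) :
  (forall (t0 t1 a0 : R) (Pi : set (R * R)),
     t0 < t1 -> point_set t0 t1 b Pi ->
     exists f : R -> R,
       [/\ solution alpha t0 t1 a0 Pi f,
           f t0 = a0 &
           forall g : R -> R, solution alpha t0 t1 a0 Pi g ->
             forall t, t0 <= t < t1 -> g t = f t]) /\
  (forall s t : R, s < t ->
     exists Phi : R -> set (R * R) -> R,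
       forall (t0 t1 a0 : R) (Pi : set (R * R)) (f : R -> R),
         t0 <= s -> t < t1 -> point_set t0 t1 b Pi ->
         solution alpha t0 t1 a0 Pi f ->
         f t = Phi (f s) (Pi `&` ([set` `]s, t]] `*` setT))).
Proof.
split=> [t0 t1 a0 Pi t01 PiP|s t st].
  have [f fS] := solution_exists a_gt0 ltab alpha_ab alphaC1 a0 PiP.
  have start g := @solution_start _ _ _ _ a_gt0 ltab alpha_ab alphaC1
    _ _ a0 _ g t01 PiP.
  exists f; split=> //; first exact: start.
  move=> g gS t /andP[]; rewrite le_eqVlt => /orP[/eqP<- _|t0t tt1].
    by rewrite !start.
  apply: (@solution_determined _ _ _ _ a_gt0 ltab alpha_ab alphaC1
    t0 t t0 t1 a0 Pi g t0 t1 a0 Pi f) => //.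
  by rewrite !start.
(* The value at [t] of any solution matching the given data; it exists and is
   unique as soon as there is such a solution. *)
pose value c P := [set y | exists t0 t1 a0 Pi f,
  [/\ t0 <= s, t < t1, point_set t0 t1 b Pi & solution alpha t0 t1 a0 Pi f] /\
  [/\ f s = c, Pi `&` ([set` `]s, t]] `*` setT) = P & f t = y]].
exists (fun c P => xget 0 (value c P)) => t0 t1 a0 Pi f t0s tt1 PiP fS.
have : value (f s) (Pi `&` ([set` `]s, t]] `*` setT)) (f t).
  by exists t0, t1, a0, Pi, f.
move=> /(xgetI 0) [t0' [t1' [a0' [Pi' [f' [[t0s' tt1' PiP' fS'] [ff' PP' <-]]]]]]].
exact: (@solution_determined _ _ _ _ a_gt0 ltab alpha_ab alphaC1
  s t t0 t1 a0 Pi f t0' t1' a0' Pi' f').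
Qed.
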